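(* Let $\mathcal{L}\subset\mathbb{S}^n$ be a regular linear subspace. The following are equivalent: (i) The ML degree of $\mathcal{L}$ is zero. (ii) The restriction $\pi_{L^\perp}|_{L^{-1}}$ of the projection $\pi_{L^\perp}$ is not dominant. (iii) The join of $L^{-1}$ and $L^\perp$ is not the whole space $\mathbb{P}\mathbb{S}^n$. (iv) A generic $K\in\mathcal{L}$ satisfies $(K\mathcal{L}^\perp K)\cap\mathcal{L}\neq\{0\}$. (v) For every pair of bases $\{A_i\}_{i=1}^c$ of $\mathcal{L}^\perp$ and $\{B_k\}_{k=1}^d$ of $\mathcal{L}$, the polynomial $\det(M)\in\mathbb{C}[s_1,\dots,s_d]$ vanishes, where $M$ is the $c\times c$ matrix with entries $M_{ij}=\sum_{k,l=1}^d s_ks_l\,\mathrm{tr}(A_iB_kA_jB_l)$.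
   Context: $\mathbb{S}^n$ denotes the space of complex symmetric $n\times n$ matrices, $\mathbb{P}\mathbb{S}^n$ its projectivization. A linear subspace $\mathcal{L}$ is regular if it contains a full-rank matrix. $\mathcal{L}^\perp=\{\Sigma\in\mathbb{S}^n:\mathrm{tr}(K\Sigma)=0\ \forall K\in\mathcal{L}\}$; $K\mathcal{L}^\perp K=\{K\Sigma K:\Sigma\in\mathcal{L}^\perp\}$. The reciprocal variety $\mathcal{L}^{-1}$ is the Zariski closure of the set of inverses of invertible matrices in $\mathcal{L}$. The ML degree of $\mathcal{L}$ is the number of matrices in $\mathcal{L}^{-1}\cap(\mathcal{L}^\perp+S)$ for generic $S\in\mathbb{S}^n$. $L^{-1},L^\perp$ are the projectivizations. For $S\in\mathbb{P}\mathbb{S}^n$, $L^\perp_S$ is the projective span of $L^\perp$ and $S$. The projection $\pi_{L^\perp}:\mathbb{P}\mathbb{S}^n\dashrightarrow\{W\in\mathrm{Gr}(\dim L^\perp+1,\mathbb{P}\mathbb{S}^n): L^\perp\subset W\}\cong\mathbb{P}^{\dim L}$ sends $S\mapsto L^\perp_S$. *)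

(* Defs.v *)
From mathcomp Require Import all_boot all_algebra.
From mathcomp Require Import Rstruct.
From mathcomp Require Import complex.
From mathcomp Require Import mpoly.

Set Implicit Arguments.
Unset Strict Implicit.
Unset Printing Implicit Defensive.

Import GRing.Theory.
Local Open Scope ring_scope.

Definition CC : numClosedFieldType := complex Rdefinitions.R.

Section Defs.
Variable n : nat.
Local Notation Mat := 'M[CC]_n.

Definition symm (A : Mat) : Prop := A^T = A.

Definition ev (p : {mpoly CC[n * n]}) (A : Mat) : CC :=
  p.@[fun i => mxvec A 0 i].

Definition sym_subspace (L : {vspace Mat}) : Prop :=
  forall K, K \in L -> symm K.

Definition regular (L : {vspace Mat}) : Prop :=
  exists2 K, K \in L & K \in unitmx.

Definition Lperp (L : {vspace Mat}) (S : Mat) : Prop :=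
  symm S /\ forall K, K \in L -> \tr (K *m S) = 0.

(* Zariski closure (in the space of matrices; it stays inside S^n
   for subsets of S^n) *)
Definition zar_closure (X : Mat -> Prop) (S : Mat) : Prop :=
  forall p : {mpoly CC[n * n]}, (forall Y, X Y -> ev p Y = 0) -> ev p S = 0.

(* the reciprocal variety L^{-1} (affine cone) *)
Definition reciprocal (L : {vspace Mat}) (S : Mat) : Prop :=
  zar_closure (fun Y => exists2 K, K \in L & K \in unitmx /\ Y = invmx K) S.

Definition generic_sym (P : Mat -> Prop) : Prop :=
  exists p : {mpoly CC[n * n]},
    (exists S0, symm S0 /\ ev p S0 <> 0) /\
    (forall S, symm S -> ev p S <> 0 -> P S).

Definition generic_in (L : {vspace Mat}) (P : Mat -> Prop) : Prop :=
  exists p : {mpoly CC[n * n]},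
    (exists2 K0, K0 \in L & ev p K0 <> 0) /\
    (forall K, K \in L -> ev p K <> 0 -> P K).

Definition ML_degree_is (L : {vspace Mat}) (d : nat) : Prop :=
  generic_sym (fun S => exists s : seq Mat,
    [/\ uniq s, size s = d &
        forall X, X \in s <-> (reciprocal L X /\ exists2 A, Lperp L A & X = A + S)]).

(* Dominance of pi_{L^perp} restricted to L^{-1}.  The target
   {W in Gr : L^perp subset W} is P(S^n / L^perp); homogeneous polynomial
   functions on S^n / L^perp are the homogeneous polynomials f on S^n
   invariant under translation by L^perp.  The restriction is dominant iff
   no such nonzero f vanishes on (the cone over) L^{-1}. *)
Definition proj_restr_dominant (L : {vspace Mat}) : Prop :=
  ~ exists (f : {mpoly CC[n * n]}) (e : nat),
      [/\ f \is e.-homog,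
          (forall S A, symm S -> Lperp L A -> ev f (S + A) = ev f S),
          (exists S0, symm S0 /\ ev f S0 <> 0) &
          (forall X, reciprocal L X -> ev f X = 0)].

(* affine cone over the join of L^{-1} and L^perp *)
Definition join_cone (L : {vspace Mat}) (S : Mat) : Prop :=
  zar_closure (fun Y => exists X A, [/\ reciprocal L X, Lperp L A & Y = X + A]) S.

Definition basis_perp (L : {vspace Mat}) (c : nat) (A : c.-tuple Mat) : Prop :=
  [/\ free A, (forall i, Lperp L (tnth A i)) &
      (forall S, Lperp L S -> S \in <<A>>%VS)].

Definition Mmat (c d : nat) (A : c.-tuple Mat) (B : d.-tuple Mat)
  : 'M[{mpoly CC[d]}]_c :=
  \matrix_(i < c, j < c)
    \sum_(k < d) \sum_(l < d)
      ('X_k * 'X_l * (\tr (tnth A i *m tnth B k *m tnth A j *m tnth B l))%:MP).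

End Defs.

(* Main.v *)
Require Import Defs.
From HB Require Import structures.
From Stdlib Require Import Classical.
From mathcomp Require Import all_boot all_algebra.
From mathcomp Require Import mpoly ring.

Set Implicit Arguments.
Unset Strict Implicit.
Unset Printing Implicit Defensive.

Import GRing.Theory Num.Theory.
Local Open Scope ring_scope.

(* Fix a basis (B_1, ..., B_d) of L. The trace form identifies S^n / L^perp with C^d through
   S |-> (tr (B_k S))_k, so conditions (i)-(iii) say that the coordinates tr (B_k K^-1), as
   rational functions of K in L, satisfy a polynomial relation. Since L^-1 is a cone, they may be
   replaced by the polynomials det K ^ 2 * tr (B_k K^-1), and by the Jacobian criterion a relation
   between these exists iff their Jacobian determinant J vanishes identically. At an invertible K,
   the differential kills W in L iff K^-1 W K^-1 is in L^perp, so J vanishes at K iff K L^perp K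
   meets L nontrivially. The latter also describes the zeros of det M, because L is the orthogonal
   complement of L^perp. *)

(** * Derivations *)

Definition derivation_along (R S : nzRingType) (phi d : R -> S) :=
  forall x y, d (x * y) = d x * phi y + phi x * d y.

Section Derivation.
Variables (R S : comNzRingType) (phi : {rmorphism R -> S}) (d : {additive R -> S}).
Hypothesis d_derivation : derivation_along phi d.

Lemma derivation1 : d 1 = 0.
Proof.
have := d_derivation 1 1; rewrite mulr1 rmorph1 mulr1 mul1r => /eqP.
by rewrite addrC -subr_eq subrr eq_sym => /eqP.
Qed.

Lemma derivationX x e : d (x ^+ e) = phi x ^+ e.-1 * d x *+ e.
Proof.
elim: e => [|e IHe]; first by rewrite expr0 derivation1 mulr0n.
rewrite exprS d_derivation IHe rmorphXn mulrC mulrS; congr (_ + _).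
case: e {IHe} => [|e]; first by rewrite !mulr0n mulr0.
by rewrite -mulrnAr mulrA -exprS -mulrnAr.
Qed.

Lemma derivation_sign_mul (b : bool) x : d ((-1) ^+ b * x) = (-1) ^+ b * d x.
Proof. by rewrite !mulr_sign; case: b; rewrite ?raddfN. Qed.

Lemma derivation_prod_seq (I : eqType) (s : seq I) (F : I -> R) : uniq s ->
  d (\prod_(i <- s) F i) =
  \sum_(j <- s) d (F j) * \prod_(i <- s | i != j) phi (F i).
Proof.
elim: s => [|a s IHs]; first by rewrite !big_nil derivation1.
case/andP=> aNs us; rewrite !big_cons eqxx d_derivation {}IHs // rmorph_prod.
congr (d _ * _ + _).
  rewrite [RHS]big_seq_cond [LHS]big_seq; apply: eq_bigl => i.
  by case: eqP => [->|_]; rewrite ?(negPf aNs) ?andbT.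
rewrite mulr_sumr; apply: eq_big_seq => j js; rewrite big_cons mulrCA.
by case: eqP js aNs => [-> ->|].
Qed.

Lemma derivation_prod (I : finType) (F : I -> R) :
  d (\prod_i F i) = \sum_j d (F j) * \prod_(i | i != j) phi (F i).
Proof. exact/derivation_prod_seq/index_enum_uniq. Qed.

Lemma derivation_mulmx m n p (A : 'M[R]_(m, n)) (B : 'M[R]_(n, p)) :
  map_mx d (A *m B) = map_mx d A *m map_mx phi B + map_mx phi A *m map_mx d B.
Proof.
apply/matrixP => i j; rewrite !mxE raddf_sum -big_split; apply: eq_bigr => k _.
by rewrite !mxE /= d_derivation.
Qed.

(* Expanding the derivative of the Leibniz formula row by row gives the determinants of the
   matrices with one row differentiated, and expanding those along that row gives the adjugate. *)
Lemma derivation_det n (M : 'M[R]_n) :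
  d (\det M) = \tr (\adj (map_mx phi M) *m map_mx d M).
Proof.
pose dM r : 'M_n := \matrix_(i, j) if i == r then d (M i j) else phi (M i j).
transitivity (\sum_r \det (dM r)).
  rewrite /determinant raddf_sum exchange_big /=; apply: eq_bigr => s _.
  rewrite derivation_sign_mul derivation_prod mulr_sumr; apply: eq_bigr => r _.
  rewrite [in RHS](bigD1 r) //= mxE eqxx; congr (_ * (_ * _)).
  by apply: eq_bigr => i /negPf ir; rewrite mxE ir.
rewrite mxtrace_mulC; apply: eq_bigr => r _; rewrite (expand_det_row _ r) mxE.
apply: eq_bigr => j _; rewrite !mxE eqxx; congr (_ * (_ * \det _)).
by apply/matrixP => a b; rewrite !mxE eq_sym (negPf (neq_lift _ _)).
Qed.

Lemma derivation_mmap (A : comNzRingType) n (f : {rmorphism A -> R}) (h : 'I_n -> R)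
    (p : {mpoly A[n]}) :
  (forall c, d (f c) = 0) ->
  d (mmap f h p) = \sum_j phi (mmap f h p^`M(j)) * d (h j).
Proof.
move=> df; elim/mpolyind: p => [|c m p _ _ IHp].
  by rewrite mmap0 raddf0 big1 // => j _; rewrite mderiv0 mmap0 rmorph0 mul0r.
rewrite mmapD raddfD /= IHp mmapZ d_derivation df mul0r add0r mmapX derivation_prod.
rewrite mulr_sumr -big_split; apply: eq_bigr => j _ /=.
rewrite mderivD mderivZ mderivX mmapD rmorphD mulrDl; congr (_ + _).
rewrite !mmapZ mmapX /mmap1 [in RHS](bigD1 j) //= mnmBE mnm1E eqxx subn1.
rewrite rmorph_nat !rmorphM rmorph_nat rmorphXn rmorph_prod derivationX -mulr_natl.
rewrite [in RHS](eq_bigr (fun i => phi (h i ^+ m i))) => [|i /negPf ij]; first by ring.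
by rewrite mnmBE mnm1E eq_sym ij subn0.
Qed.

End Derivation.

Lemma mderiv_derivation (R : comNzRingType) n (i : 'I_n) :
  derivation_along idfun (mderiv (R := R) i).
Proof. by move=> p q; apply: mderivM. Qed.

Lemma deriv_derivation (R : comNzRingType) : derivation_along idfun (@deriv R).
Proof. by move=> p q; apply: derivM. Qed.

Lemma mderiv_comp (R : comNzRingType) n k (p : {mpoly R[n]}) (g : n.-tuple {mpoly R[k]}) i :
  (p \mPo g)^`M(i) = \sum_j (p^`M(j) \mPo g) * (tnth g j)^`M(i).
Proof.
by apply: (derivation_mmap (@mderiv_derivation R k i)) => c; apply: mderivC.
Qed.

Lemma mderivU (R : nzRingType) n (i j : 'I_n) : ('X_j : {mpoly R[n]})^`M(i) = (j == i)%:R.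
Proof.
rewrite mderivX mnm1E; case: eqP => [->|_]; last by rewrite scale0r.
by rewrite scale1r (_ : (_ - _)%MM = 0%MM) ?mpolyX0 //; apply/mnmP => k; rewrite !mnmE subnn.
Qed.

Definition dirderiv (R : comNzRingType) n (v w : 'I_n -> R) (p : {mpoly R[n]}) : R :=
  \sum_i w i * (p^`M(i)).@[v].

Lemma dirderiv_is_zmod_morphism (R : comNzRingType) n (v w : 'I_n -> R) :
  zmod_morphism (dirderiv v w).
Proof.
move=> p q; rewrite -sumrB; apply: eq_bigr => i _.
by rewrite mderivB mevalB mulrBr.
Qed.

HB.instance Definition _ (R : comNzRingType) n (v w : 'I_n -> R) :=
  GRing.isZmodMorphism.Build {mpoly R[n]} R (dirderiv v w) (dirderiv_is_zmod_morphism v w).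

Lemma dirderiv_derivation (R : comNzRingType) n (v w : 'I_n -> R) :
  derivation_along (meval v) (dirderiv v w).
Proof.
move=> p q; rewrite mulr_suml mulr_sumr -big_split; apply: eq_bigr => i _ /=.
by rewrite mderivM mevalD !mevalM; ring.
Qed.

Lemma dirderivC (R : comNzRingType) n (v w : 'I_n -> R) c : dirderiv v w c%:MP = 0.
Proof. by rewrite /dirderiv big1 // => i _; rewrite mderivC meval0 mulr0. Qed.

Lemma dirderivU (R : comNzRingType) n (v w : 'I_n -> R) i : dirderiv v w 'X_i = w i.
Proof.
rewrite /dirderiv (bigD1 i) //= mderivU eqxx meval1 mulr1 big1 ?addr0 // => j ne.
by rewrite mderivU eq_sym (negPf ne) meval0 mulr0.
Qed.

(** * Polynomials in characteristic zero *)

Lemma msize_mderiv_lt (R : nzRingType) n (p : {mpoly R[n]}) i :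
  p != 0 -> (msize p^`M(i) < msize p)%N.
Proof.
move=> p0; rewrite (mpolySpred _ p0) ltnS; apply/bigmax_leqP_seq => m.
rewrite mcoeff_msupp mcoeff_mderiv => dpm _.
have : (m + U_(i))%MM \in msupp p.
  by rewrite mcoeff_msupp; apply: contra dpm => /eqP ->; rewrite mul0rn.
by move/msize_mdeg_lt; rewrite mdegD mdeg1 addn1 (mpolySpred _ p0) ltnS.
Qed.

Lemma horner_mmap (R : comNzRingType) n (h : 'I_n -> {poly R}) (p : {mpoly R[n]}) x :
  (mmap polyC h p).[x] = p.@[fun j => (h j).[x]].
Proof.
rewrite mevalE /mmap horner_sum; apply: eq_bigr => m _.
rewrite hornerM hornerC /mmap1 horner_prod; congr (_ * _).
by apply: eq_bigr => j _; rewrite horner_exp.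
Qed.

Lemma meval_dhomog (R : comNzRingType) n (p : {mpoly R[n]}) e t v :
  p \is e.-homog -> p.@[fun i => t * v i] = t ^+ e * p.@[v].
Proof.
move/dhomogP => hp; rewrite !mevalE mulr_sumr; apply: eq_big_seq => m /hp <-.
rewrite /= mdegE -prodrXr mulrCA; congr (_ * _).
by rewrite -big_split; apply: eq_bigr => i _; rewrite exprMn.
Qed.

Lemma exists_pihomog_neq0 (R : nzRingType) n (p : {mpoly R[n]}) :
  p != 0 -> exists e, pihomog mdeg e p != 0.
Proof.
move=> p0; apply: NNPP => pe; case/eqP: p0.
rewrite (pihomog_partitionE (leqnn (msize p))) big1 // => e _.
by apply/eqP/negPn/negP => pe0; apply: pe; exists e.
Qed.

Lemma dhomog_comp_linear (R : comNzRingType) n k (p : {mpoly R[n]}) (g : n.-tuple {mpoly R[k]}) e :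
  p \is e.-homog -> (forall i, tnth g i \is 1.-homog) -> p \mPo g \is e.-homog.
Proof.
move=> /dhomogP hp hg; rewrite comp_mpolyEX big_seq rpred_sum // => m /hp <-.
rewrite rpredZ // comp_mpolyX /= mdegE.
apply: (big_ind2 (fun q d => q \is d.-homog)) => [|p1 d1 p2 d2|i _].
- exact: dhomog1.
- exact: dhomogM.
- by have := dhomogMn (m i) (hg i); rewrite mul1n.
Qed.

Lemma comp_mpolyA (R : comNzRingType) n k l (p : {mpoly R[n]}) (g : n.-tuple {mpoly R[k]})
    (h : k.-tuple {mpoly R[l]}) :
  (p \mPo g) \mPo h = p \mPo [tuple tnth g i \mPo h | i < n].
Proof.
rewrite [p \mPo g]comp_mpolyEX [RHS]comp_mpolyEX raddf_sum; apply: eq_bigr => m _ /=.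
rewrite comp_mpolyZ !comp_mpolyX rmorph_prod; congr (_ *: _).
by apply: eq_bigr => i _; rewrite rmorphXn tnth_mktuple.
Qed.

Section CharacteristicZero.
Variable R : idomainType.
Hypothesis char0 : [pchar R] =i pred0.

Let natr_eq0 k : (k%:R == 0 :> R) = (k == 0)%N.
Proof. by move/pcharf0P: char0 => ->. Qed.

Lemma poly_eq0_horner (p : {poly R}) : (forall x, x != 0 -> p.[x] = 0) -> p = 0.
Proof.
move=> px; apply/eqP/negPn/negP => p0.
pose xs := [seq i.+1%:R : R | i <- iota 0 (size p)].
have xs_root : all (root p) xs.
  by apply/allP => _ /mapP [i _ ->]; apply/rootP/px; rewrite natr_eq0.
have xs_uniq : uniq xs.
  rewrite map_inj_uniq ?iota_uniq // => i j.
  wlog le_ij : i j / (i <= j)%N => [sym|].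
    by case/orP: (leq_total i j) => /sym // eq_sym /esym/eq_sym.
  move/esym/eqP; rewrite -subr_eq0 -natrB // natr_eq0 subSS subn_eq0 => le_ji.
  by apply/eqP; rewrite eqn_leq le_ij.
by have := max_poly_roots p0 xs_root xs_uniq; rewrite size_map size_iota ltnn.
Qed.

Lemma mulr_even_fix_eq0 (t : R) m : t = t *+ 2 * m%:R -> t = 0.
Proof.
case: m => [|m] t2m; first by rewrite t2m mulr0.
suff /eqP : t * (m + m.+1)%:R = 0 by rewrite mulf_eq0 natr_eq0 addnS orbF => /eqP.
by rewrite natrD; move/eqP: t2m; rewrite -subr_eq0 => /eqP t2m; rewrite -[RHS]oppr0 -t2m; ring.
Qed.

Lemma mderiv_eq0_msupp n (p : {mpoly R[n]}) i m :
  p^`M(i) = 0 -> m \in msupp p -> m i = 0%N.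
Proof.
move=> dp; rewrite mcoeff_msupp; apply: contraNeq => mi.
have := mcoeff_mderiv i p (m - U_(i))%MM; rewrite dp mcoeff0 submK; last first.
  by apply/mnm_lepP => j; rewrite mnm1E; case: eqP => // <-; rewrite lt0n.
by move/esym/eqP; rewrite -mulr_natr mulf_eq0 natr_eq0 orbF.
Qed.

Lemma mderiv_eq0_const n (p : {mpoly R[n]}) :
  (forall i, p^`M(i) = 0) -> p = (p@_0)%:MP.
Proof.
move=> dp; apply/mpolyP => m; rewrite mcoeffC.
case: (m =P 0%MM) => [->|m0]; first by rewrite mulr1.
rewrite mulr0; apply/eqP; rewrite mcoeff_eq0; apply/negP => mp.
by case: m0; apply/mnmP => i; rewrite mnm0E (mderiv_eq0_msupp (dp i)).
Qed.

(* Restricted to the line through v in the direction of the i-th axis, a polynomial function that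
   vanishes everywhere gives the zero univariate polynomial; its derivative at 0 is the value of
   the partial derivative at v. *)
Lemma meval_eq0_mderiv n (p : {mpoly R[n]}) i :
  (forall v, p.@[v] = 0) -> forall v, (p^`M(i)).@[v] = 0.
Proof.
move=> p0 v; pose line j := (v j)%:P + (j == i)%:R *: 'X.
have line0 : mmap polyC line p = 0.
  by apply: poly_eq0_horner => x _; rewrite horner_mmap p0.
have dline j : (line j)^`() = ((j == i)%:R)%:P.
  by rewrite derivD derivC derivZ derivX add0r alg_polyC.
have := derivation_mmap (@deriv_derivation R) line p (@derivC R).
rewrite line0 raddf0 (bigD1 i) //= dline eqxx mulr1 big1 => [|j /negPf ij]; last first.
  by rewrite dline ij mulr0.
move/(congr1 (fun q => q.[0])); rewrite addr0 horner0 horner_mmap => e.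
by rewrite [RHS]e; apply: meval_eq => j; rewrite !hornerE.
Qed.

Lemma mpoly_eq0_meval n (p : {mpoly R[n]}) : (forall v, p.@[v] = 0) -> p = 0.
Proof.
have [k] := ubnP (msize p); elim: k p => // k IHk p; rewrite ltnS => pk p0.
apply/eqP/negPn/negP => p_neq0.
have dp i : p^`M(i) = 0.
  apply: IHk; first exact: leq_trans (msize_mderiv_lt i p_neq0) pk.
  exact: meval_eq0_mderiv.
move: p_neq0 (p0 (fun=> 0)); rewrite (mderiv_eq0_const dp) mevalC => + c0.
by rewrite c0 eqxx.
Qed.

Lemma mpoly_neq0_meval n (p : {mpoly R[n]}) : p != 0 -> exists v, p.@[v] != 0.
Proof.
move=> p0; apply: NNPP => pv; case/eqP: p0; apply: mpoly_eq0_meval => v.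
by apply/eqP/negPn/negP => pv0; apply: pv; exists v.
Qed.

Lemma meval_pihomog_eq0 n (p : {mpoly R[n]}) v :
  (forall t, t != 0 -> p.@[fun i => t * v i] = 0) ->
  forall e, (pihomog mdeg e p).@[v] = 0.
Proof.
move=> pv e; pose k := maxn (msize p) e.+1.
pose q := \poly_(i < k) (pihomog mdeg i p).@[v].
suff /polyP/(_ e) : q = 0 by rewrite coef_poly leq_maxr coef0.
apply: poly_eq0_horner => t /pv; rewrite {1}(pihomog_partitionE (leq_maxl (msize p) e.+1)) => <-.
rewrite horner_poly raddf_sum; apply: eq_bigr => i _ /=.
by rewrite (meval_dhomog _ _ (pihomogP _ _ _)) mulrC.
Qed.

Lemma comp_mpoly_mderiv0 n k (f : {mpoly R[n]}) i (g h : n.-tuple {mpoly R[k]}) :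
  f^`M(i) = 0 -> (forall j, j != i -> tnth g j = tnth h j) -> f \mPo g = f \mPo h.
Proof.
move=> df gh; rewrite !comp_mpolyEX; apply: eq_big_seq => m mf; congr (_ *: _).
rewrite !comp_mpolyX; apply: eq_bigr => j _.
by have [->|/gh ->//] := eqVneq j i; rewrite (mderiv_eq0_msupp df mf) !expr0.
Qed.

End CharacteristicZero.

(** * The Jacobian criterion *)

Definition alg_dependent (R : nzRingType) n k (g : k.-tuple {mpoly R[n]}) :=
  exists2 f : {mpoly R[k]}, f != 0 & f \mPo g = 0.

Definition jacobian (R : nzRingType) n k (g : k.-tuple {mpoly R[n]}) : 'M[{mpoly R[n]}]_(n, k) :=
  \matrix_(i, j) (tnth g j)^`M(i).

Lemma mul_jacobian_dirderiv (R : comNzRingType) n k (g : k.-tuple {mpoly R[n]}) v (w : 'rV_n) :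
  w *m map_mx (meval v) (jacobian g) = \row_j dirderiv v (w 0) (tnth g j).
Proof. by apply/rowP => j; rewrite !mxE; apply: eq_bigr => i _; rewrite !mxE. Qed.

Lemma alg_dependent_minimal (R : nzRingType) n k (g : k.-tuple {mpoly R[n]}) :
  alg_dependent g ->
  exists f, [/\ f != 0, f \mPo g = 0 & forall i, f^`M(i) \mPo g = 0 -> f^`M(i) = 0].
Proof.
case=> f; have [s] := ubnP (msize f); elim: s f => // s IHs f; rewrite ltnS => fs f0 fg.
have [/existsP [i /andP[/eqP dfg df]]|min] :=
    boolP [exists i, (f^`M(i) \mPo g == 0) && (f^`M(i) != 0)].
  by apply: (IHs f^`M(i)) => //; apply: leq_trans (msize_mderiv_lt i f0) fs.
exists f; split=> // i /eqP dfg; apply: contraNeq min => df.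
by apply/existsP; exists i; rewrite dfg.
Qed.

Lemma alg_dependent_behead (R : idomainType) n k (h : {mpoly R[n]}) (g : k.-tuple {mpoly R[n]}) f :
  [pchar R] =i pred0 -> f != 0 -> f \mPo cons_tuple h g = 0 -> f^`M(ord0) = 0 ->
  alg_dependent g.
Proof.
move=> char0 f0 fhg df.
pose drop : k.+1.-tuple {mpoly R[k]} := cons_tuple 0 [tuple 'X_i | i < k].
pose shift : k.-tuple {mpoly R[k.+1]} := [tuple 'X_(lift ord0 i) | i < k].
exists (f \mPo drop).
  apply: contra_neq f0 => f_drop; rewrite -[f]comp_mpoly_id.
  have -> : f \mPo [tuple 'X_i | i < k.+1] = (f \mPo drop) \mPo shift.
    rewrite comp_mpolyA; apply: (comp_mpoly_mderiv0 char0 df) => j.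
    case: (unliftP ord0 j) => [i ->|-> /eqP//] _.
    by rewrite !tnth_mktuple tnthS tnth_mktuple comp_mpolyXU -tnth_nth tnth_mktuple.
  by rewrite f_drop comp_mpoly0.
rewrite comp_mpolyA -[RHS]fhg; apply: (comp_mpoly_mderiv0 char0 df) => j.
case: (unliftP ord0 j) => [i ->|-> /eqP//] _.
by rewrite tnth_mktuple !tnthS tnth_mktuple comp_mpolyXU -tnth_nth.
Qed.

Theorem alg_dependent_jacobian (R : idomainType) n (g : n.-tuple {mpoly R[n]}) :
  [pchar R] =i pred0 -> alg_dependent g -> \det (jacobian g) = 0.
Proof.
move=> char0 /alg_dependent_minimal [f [f0 fg f_min]].
pose grad : 'rV[{mpoly R[n]}]_n := \row_j (f^`M(j) \mPo g).
have grad_jac : grad *m (jacobian g)^T = 0.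
  apply/rowP => j; rewrite !mxE -[RHS](mderiv0 _ j) -[in RHS]fg mderiv_comp.
  by apply: eq_bigr => l _; rewrite !mxE.
apply/eqP; rewrite -det_tr; apply/det0P; exists grad => //.
apply: contra_neq f0 => /rowP grad0.
have df i : f^`M(i) = 0 by apply: f_min; have := grad0 i; rewrite !mxE.
move: fg; rewrite (mderiv_eq0_const char0 df) comp_mpolyC => /eqP.
by rewrite mpolyC_eq0 => /eqP ->.
Qed.

Lemma exists_linear_relation (F : fieldType) (I J : finType) (A : I -> J -> F) :
  (#|J| < #|I|)%N ->
  exists2 c : I -> F, (exists i, c i != 0) & forall j, \sum_i c i * A i j = 0.
Proof.
move=> ltJI; pose M : 'M[F]_(#|I|, #|J|) := \matrix_(i, j) A (enum_val i) (enum_val j).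
have : kermx M != 0.
  rewrite kermx_eq0 -row_leq_rank -ltnNge; exact: leq_ltn_trans (rank_leq_col _) ltJI.
case/rowV0Pn => v /sub_kermxP/rowP vM /rV0Pn [i vi]; exists (fun i => v 0 (enum_rank i)).
  by exists (enum_val i); rewrite enum_valK.
move=> j; have := vM (enum_rank j); rewrite !mxE => vMj; rewrite -[RHS]vMj.
rewrite (reindex (@enum_val I I)); last exact/onW_bij/enum_val_bij.
by apply: eq_bigr => k _; rewrite mxE enum_valK enum_rankK.
Qed.

Lemma mpoly_exists_linear_relation (F : fieldType) n b (I : finType) (p : I -> {mpoly F[n]}) :
  (forall i, msize (p i) <= b)%N -> (b ^ n < #|I|)%N ->
  exists2 c : I -> F, (exists i, c i != 0) & \sum_i c i *: p i = 0.
Proof.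
move=> p_size ltI.
have [|c c0 c_rel] := @exists_linear_relation F I {ffun 'I_n -> 'I_b}
    (fun i e => (p i)@_[multinom (e l : nat) | l < n]).
  by rewrite card_ffun !card_ord.
exists c => //; apply/mpolyP => m; rewrite mcoeff0 linear_sum /=.
have [lt_mb|le_bm] := ltnP (mdeg m) b; last first.
  rewrite big1 // => i _; rewrite mcoeffZ memN_msupp_eq0 ?mulr0 //.
  exact/msize_mdeg_ge/(leq_trans (p_size i)).
have lt_m l : (m l < b)%N.
  by apply: leq_ltn_trans lt_mb; rewrite mdegE (bigD1 l) //= leq_addr.
rewrite -[RHS](c_rel [ffun l => Ordinal (lt_m l)]); apply: eq_bigr => i _.
by rewrite mcoeffZ; congr (_ * _@__); apply/mnmP => l; rewrite mnmE ffunE.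
Qed.

Lemma msizeM_leS (R : idomainType) n (p q : {mpoly R[n]}) a b :
  (msize p <= a.+1 -> msize q <= b.+1 -> msize (p * q) <= (a + b).+1)%N.
Proof.
have [->|p0] := eqVneq p 0; first by rewrite mul0r msize0.
have [->|q0] := eqVneq q 0; first by rewrite mulr0 msize0.
move=> pa qb; rewrite msizeM //.
by have := leq_add pa qb; rewrite addSn addnS; case: (_ + _)%N.
Qed.

Lemma msize_comp_mpolyX (R : idomainType) n k (g : k.-tuple {mpoly R[n]}) a m :
  (forall i, msize (tnth g i) <= a.+1)%N ->
  (msize ('X_[m] \mPo g) <= (mdeg m * a).+1)%N.
Proof.
move=> ga; rewrite comp_mpolyX mdegE big_distrl /=.
apply: (big_ind2 (fun p d => msize p <= d.+1)%N) => [|p d q e|i _].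
- by rewrite msize1.
- exact: msizeM_leS.
- elim: (m i) => [|e IHe]; first by rewrite expr0 msize1.
  by rewrite exprS mulSn msizeM_leS.
Qed.

(* There are N ^ k monomials with exponents below N in k variables, and their values at g lie in
   a space whose dimension is O(N ^ n). *)
Lemma ltn_alg_dependent (F : fieldType) n k (g : k.-tuple {mpoly F[n]}) :
  (n < k)%N -> alg_dependent g.
Proof.
move=> lt_nk; pose a := (\sum_i msize (tnth g i))%N.
have g_size i : (msize (tnth g i) <= a.+1)%N by rewrite leqW // /a (bigD1 i) //= leq_addr.
pose N := ((k * a).+1 ^ n).+1.
pose mon (e : {ffun 'I_k -> 'I_N}) : 'X_{1..k} := [multinom (e i : nat) | i < k].
have mon_inj : injective mon.
  by move=> e1 e2 /mnmP e12; apply/ffunP => i; apply/val_inj; have := e12 i; rewrite !mnmE.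
have mon_size e : (msize ('X_[mon e] \mPo g) <= N * (k * a).+1)%N.
  apply: leq_trans (msize_comp_mpolyX _ g_size) _.
  have mon_deg : (mdeg (mon e) <= k * N)%N.
    rewrite mdegE -[k in leqRHS]card_ord -sum_nat_const leq_sum // => i _.
    by rewrite mnmE ltnW.
  by rewrite mulnS -addn1 addnC leq_add // mulnCA mulnA leq_mul.
have [|c [e ce] c_rel] := mpoly_exists_linear_relation mon_size.
  rewrite card_ffun !card_ord expnMn -[k in X in (_ < X)%N](subnKC lt_nk) expnD expnSr.
  rewrite -mulnA ltn_pmul2l ?expn_gt0 //.
  by rewrite (leq_trans (ltnSn _)) // leq_pmulr ?expn_gt0.
exists (\sum_e c e *: 'X_[mon e]).
  apply: contra_neq ce => /mpolyP/(_ (mon e)).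
  rewrite mcoeff0 linear_sum (bigD1 e) //= mcoeffZ mcoeffX eqxx mulr1 big1 ?addr0 // => e' ne.
  by rewrite mcoeffZ mcoeffX (inj_eq mon_inj) (negPf ne) mulr0.
by rewrite raddf_sum -[RHS]c_rel; apply: eq_bigr => e' _; rewrite /= comp_mpolyZ.
Qed.

(* Each X_i is algebraic over g. If g is independent, differentiating a minimal relation for each
   of them gives a matrix identity E *m (jacobian g)^T = D with D diagonal and invertible. *)
Theorem jacobian_alg_dependent (F : fieldType) n (g : n.-tuple {mpoly F[n]}) :
  [pchar F] =i pred0 -> \det (jacobian g) = 0 -> alg_dependent g.
Proof.
move=> char0 J0; apply: NNPP => g_indep.
have /fin_all_exists [f f_rel] i : exists fi : {mpoly F[n.+1]},
    fi \mPo cons_tuple 'X_i g = 0 /\ fi^`M(ord0) \mPo cons_tuple 'X_i g != 0.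
  have := ltn_alg_dependent (cons_tuple 'X_i g) (ltnSn n).
  move=> /alg_dependent_minimal [fi [fi0 fig fi_min]]; exists fi; split=> //.
  by apply/eqP => /fi_min/(alg_dependent_behead char0 fi0 fig).
pose df i j := (f i)^`M(j) \mPo cons_tuple 'X_i g.
pose E := \matrix_(i, k) df i (lift ord0 k).
pose D := \row_i - df i ord0.
have ED : E *m (jacobian g)^T = diag_mx D.
  apply/matrixP => i j; rewrite !mxE.
  have := mderiv_comp (f i) (cons_tuple 'X_i g) j.
  rewrite (f_rel i).1 mderiv0 big_ord_recl /= tnth0 mderivU eq_sym => /eqP.
  rewrite eq_sym addrC addr_eq0 -mulNr mulr_natr => /eqP <-.
  by apply: eq_bigr => k _; rewrite tnthS !mxE.
have /eqP : \det (diag_mx D) = 0 by rewrite -ED det_mulmx det_tr J0 mulr0.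
rewrite det_diag; apply/negP/prodf_neq0 => i _.
by rewrite mxE oppr_eq0 (f_rel i).2.
Qed.

(** * Linear combinations and traces *)

Definition lincomb (R : pzRingType) (V : lmodType R) d (B : d.-tuple V) (v : 'I_d -> R) : V :=
  \sum_i v i *: tnth B i.

Section Span.
Variables (F : fieldType) (V : vectType F).

Lemma span_lincombP d (B : d.-tuple V) x : x \in <<B>>%VS <-> exists v, x = lincomb B v.
Proof.
split=> [/coord_span ->|[v ->]].
  by exists (fun i => coord B i x); apply: eq_bigr => i _; rewrite (tnth_nth 0).
by apply: memv_suml => i _; apply/memvZ/memv_span/mem_tnth.
Qed.

Lemma lincomb_eq0 d (B : d.-tuple V) v : free B -> lincomb B v = 0 <-> forall i, v i = 0.
Proof.
move=> /freeP B_free; split=> [Bv|v0]; last by apply: big1 => i _; rewrite v0 scale0r.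
by apply: B_free; rewrite -[RHS]Bv; apply: eq_bigr => i _; rewrite (tnth_nth 0).
Qed.

Lemma det_eq0_lincombP d (B : d.-tuple V) (A : 'M[F]_d) (P : V -> Prop) :
  free B -> (forall w : 'rV_d, w *m A = 0 <-> P (lincomb B (w 0))) ->
  \det A = 0 <-> exists x, [/\ x \in <<B>>%VS, x <> 0 & P x].
Proof.
move=> B_free kerA; split=> [/eqP/det0P [w w0 /kerA Pw]|[x [/span_lincombP [v ->] v0 Pv]]].
  exists (lincomb B (w 0)); split=> //; first by apply/span_lincombP; exists (w 0).
  by move/(lincomb_eq0 _ B_free) => w0'; case/eqP: w0; apply/rowP => i; rewrite w0' mxE.
have vE : lincomb B ((\row_i v i) 0) = lincomb B v by apply: eq_bigr => i _; rewrite mxE.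
apply/eqP/det0P; exists (\row_i v i); last by apply/kerA; rewrite vE.
apply/eqP => row_v0; apply: v0; rewrite -vE row_v0; apply/(lincomb_eq0 _ B_free) => i.
by rewrite mxE.
Qed.

Lemma exists_vspaceP (P : V -> Prop) :
  P 0 -> (forall a x y, P x -> P y -> P (a *: x + y)) ->
  exists U : {vspace V}, forall x, x \in U <-> P x.
Proof.
move=> P0 P_lin.
suff grow (U : {vspace V}) : (forall x, x \in U -> P x) ->
    exists W : {vspace V}, forall x, x \in W <-> P x.
  by apply: (grow 0%VS) => x; rewrite memv0 => /eqP ->.
have [k] := ubnP (\dim {:V} - \dim U); elim: k U => // k IHk U; rewrite ltnS => Uk UP.
have [PU|notPU] := classic (forall x, P x -> x \in U); first by exists U => x; split=> [/UP|/PU].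
have [x notPx] := not_all_ex_not _ _ notPU; have [Px /negP xU] := imply_to_and _ _ notPx.
apply: (IHk (<[x]> + U)%VS) => [|_ /memv_addP [_ /vlineP [a ->] [y /UP Py ->]]]; last exact: P_lin.
apply: leq_trans Uk; rewrite ltn_sub2lE ?dimvS ?subvf //.
rewrite ltnNge (geq_leqif (dimv_leqif_sup (addvSr _ _))).
by apply: contra xU => /subvP -> //; rewrite (subvP (addvSl _ _)) ?memv_line.
Qed.

End Span.

Section TraceCoordinates.
Variables (R : comNzRingType) (n d : nat) (B : d.-tuple 'M[R]_n).
Implicit Types (S T : 'M[R]_n) (k : 'I_d).

Definition trace_coord S k : R := \tr (tnth B k *m S).

Lemma trace_coordD S T k : trace_coord (S + T) k = trace_coord S k + trace_coord T k.
Proof. by rewrite /trace_coord mulmxDr mxtraceD. Qed.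

Lemma trace_coordZ a S k : trace_coord (a *: S) k = a * trace_coord S k.
Proof. by rewrite /trace_coord -scalemxAr mxtraceZ. Qed.

Lemma trace_coordB S T k : trace_coord (S - T) k = trace_coord S k - trace_coord T k.
Proof. by rewrite /trace_coord mulmxBr raddfB. Qed.

Lemma trace_lincomb v S : \tr (lincomb B v *m S) = \sum_k v k * trace_coord S k.
Proof.
rewrite mulmx_suml raddf_sum; apply: eq_bigr => k _.
by rewrite -scalemxAl /= mxtraceZ.
Qed.

Lemma trace_coord_lincomb e (T : e.-tuple 'M[R]_n) v k :
  trace_coord (lincomb T v) k = \sum_j v j * trace_coord (tnth T j) k.
Proof.
rewrite /trace_coord mulmx_sumr raddf_sum; apply: eq_bigr => j _.
by rewrite -scalemxAr /= mxtraceZ.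
Qed.

End TraceCoordinates.

Lemma mxvec_dot (R : comNzRingType) m n (A B : 'M[R]_(m, n)) :
  \sum_i mxvec A 0 i * mxvec B 0 i = \tr (A *m B^T).
Proof.
rewrite (reindex _ (curry_mxvec_bij m n)) /=.
transitivity (\sum_i \sum_j A i j * B i j).
  by rewrite pair_bigA; apply: eq_bigr => -[i j] _; rewrite /= !mxvecE.
by apply: eq_bigr => i _; rewrite mxE; apply: eq_bigr => j _; rewrite mxE.
Qed.

(* A dual family for the form tr (A *m B^T) is read off a right inverse of the matrix of B; against
   symmetric matrices, each of its members may be replaced by its symmetric part. *)
Lemma exists_trace_dual (F : fieldType) n d (B : d.-tuple 'M[F]_n) :
  2 != 0 :> F -> free B -> (forall k, (tnth B k)^T = tnth B k) ->
  exists T : d.-tuple 'M[F]_n,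
    (forall v, (lincomb T v)^T = lincomb T v) /\ forall v, trace_coord B (lincomb T v) =1 v.
Proof.
move=> two0 B_free B_sym; pose N : 'M[F]_(d, n * n) := \matrix_k mxvec (tnth B k).
have N_free : row_free N.
  apply: inj_row_free => v vN; apply/rowP => k; rewrite mxE.
  apply: (iffLR (lincomb_eq0 (v 0) B_free)); apply: (can_inj mxvecK).
  rewrite linear0 linear_sum -[RHS]vN mulmx_sum_row.
  by apply: eq_bigr => i _; rewrite linearZ rowK.
pose S k : 'M[F]_n := vec_mx (row k (pinvmx N)^T).
have tr_BST j k : \tr (tnth B j *m (S k)^T) = (j == k)%:R.
  have /matrixP/(_ j k) := mulmxVp N_free.
  rewrite -mxvec_dot vec_mxK [X in _ = X -> _]mxE => <-.
  by rewrite mxE; apply: eq_bigr => i _; rewrite !mxE.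
have tr_BS j k : \tr (tnth B j *m S k) = (j == k)%:R.
  by rewrite -mxtrace_tr trmx_mul B_sym mxtrace_mulC tr_BST.
pose T := [tuple 2^-1 *: (S k + (S k)^T) | k < d].
exists T; split=> [v|v j].
  rewrite linear_sum; apply: eq_bigr => k _.
  by rewrite linearZ /= tnth_mktuple linearZ linearD /= trmxK addrC.
have tr_BT k : trace_coord B (tnth T k) j = (j == k)%:R.
  rewrite tnth_mktuple trace_coordZ trace_coordD /trace_coord tr_BS tr_BST.
  by rewrite -mulr2n -(mulr_natl (j == k)%:R 2) mulKf.
rewrite trace_coord_lincomb (bigD1 j) //= tr_BT eqxx mulr1 big1 ?addr0 // => k kj.
by rewrite tr_BT eq_sym (negPf kj) mulr0.
Qed.

(** * Polynomial families of matrices *)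

Lemma map_mx_mevalC (R : comNzRingType) d m n v (A : 'M[R]_(m, n)) :
  map_mx (meval v) (map_mx (@mpolyC d R) A) = A.
Proof. by apply/matrixP => i j; rewrite !mxE mevalC. Qed.

Section Pencil.
Variables (R : comNzRingType) (n d : nat) (B : d.-tuple 'M[R]_n).

Definition pencil : 'M[{mpoly R[d]}]_n :=
  \sum_i 'X_i *: map_mx (@mpolyC d R) (tnth B i).

Lemma meval_pencil v : map_mx (meval v) pencil = lincomb B v.
Proof.
rewrite map_mx_sum; apply: eq_bigr => i _.
by rewrite map_mxZ map_mx_mevalC /= mevalXU.
Qed.

Lemma dirderiv_pencil v w : map_mx (dirderiv v w) pencil = lincomb B w.
Proof.
rewrite map_mx_sum; apply: eq_bigr => i _; apply/matrixP => a b; rewrite !mxE.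
by rewrite /= dirderiv_derivation dirderivU dirderivC mulr0 addr0 mevalC.
Qed.

Definition trace_polys e (M : 'M[{mpoly R[e]}]_n) : d.-tuple {mpoly R[e]} :=
  [tuple \tr (map_mx (@mpolyC e R) (tnth B k) *m M) | k < d].

Lemma meval_trace_polys e (M : 'M[{mpoly R[e]}]_n) v k :
  (tnth (trace_polys M) k).@[v] = trace_coord B (map_mx (meval v) M) k.
Proof. by rewrite tnth_mktuple -trace_map_mx map_mxM map_mx_mevalC. Qed.

Lemma dirderiv_trace_polys e (M : 'M[{mpoly R[e]}]_n) v w k :
  dirderiv v w (tnth (trace_polys M) k) = trace_coord B (map_mx (dirderiv v w) M) k.
Proof.
set Bk := map_mx (@mpolyC e R) (tnth B k).
have dBk : map_mx (dirderiv v w) Bk = 0 by apply/matrixP => i j; rewrite !mxE dirderivC.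
have := derivation_mulmx (@dirderiv_derivation R e v w) Bk M.
rewrite dBk mul0mx add0r map_mx_mevalC /trace_coord => <-.
by rewrite tnth_mktuple raddf_sum; apply: eq_bigr => i _; rewrite [RHS]mxE.
Qed.

End Pencil.

(** * The inverse as a polynomial map up to scaling *)

(* The simpler \adj M would not do: it is constant on 1 x 1 matrices. *)
Definition invcone (R : comNzRingType) n (M : 'M[R]_n) : 'M[R]_n := \det M *: \adj M.

Lemma map_invcone (R S : comNzRingType) (f : {rmorphism R -> S}) n (M : 'M[R]_n) :
  map_mx f (invcone M) = invcone (map_mx f M).
Proof. by rewrite /invcone map_mxZ map_mx_adj det_map_mx. Qed.

Lemma invconeZ (R : comNzRingType) n c (M : 'M[R]_n) :
  invcone (c *: M) = c ^+ (n + n.-1) *: invcone M.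
Proof. by rewrite /invcone detZ adjZ !scalerA exprD mulrAC. Qed.

Lemma mulmx_invcone (R : comNzRingType) n (M : 'M[R]_n) :
  M *m invcone M = (\det M ^+ 2)%:M.
Proof. by rewrite -scalemxAr mul_mx_adj scale_scalar_mx expr2. Qed.

Lemma adj_unitmx (R : comUnitRingType) n (M : 'M[R]_n) :
  M \in unitmx -> \adj M = \det M *: invmx M.
Proof. by move=> uM; rewrite /invmx uM scalerA mulrV ?scale1r. Qed.

Lemma invcone_unitmx (R : comUnitRingType) n (M : 'M[R]_n) :
  M \in unitmx -> invcone M = \det M ^+ 2 *: invmx M.
Proof. by move=> uM; rewrite /invcone adj_unitmx // scalerA expr2. Qed.

Lemma derivation_invcone (R : comNzRingType) (S : comUnitRingType) (phi : {rmorphism R -> S})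
    (d : {additive R -> S}) n (M : 'M[R]_n) (K := map_mx phi M) (H := map_mx d M) :
  derivation_along phi d -> K \in unitmx ->
  map_mx d (invcone M) =
  \det K ^+ 2 *: ((\tr (invmx K *m H) *+ 2) *: invmx K - invmx K *m H *m invmx K).
Proof.
move=> d_der uK; have := derivation_mulmx d_der M (invcone M).
have -> : map_mx d (M *m invcone M) = (d (\det M ^+ 2))%:M.
  by rewrite mulmx_invcone; apply/matrixP => i j; rewrite !mxE raddfMn.
rewrite (derivationX d_der) (derivation_det d_der) map_invcone.
rewrite -/K -/H expr1 -det_map_mx -/K adj_unitmx // invcone_unitmx //.
move/esym/(canRL (addKr _))/(congr1 (mulmx (invmx K))); rewrite mulKmx // => ->.
rewrite mulmxDr mulmxN mul_mx_scalar -scalemxAl mxtraceZ -!scalemxAr mulmxA addrC.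
by rewrite scalerBr scalerA; congr (_ *: _ - _); ring.
Qed.

(* For n = 0 the exponent n + n.-1 vanishes, but then all matrices are equal. *)
Lemma exists_invcone_eq (C : numClosedFieldType) n (K : 'M[C]_n) t :
  K \in unitmx -> exists c, invcone (c *: K) = t *: invmx K.
Proof.
case: n K => [|n] K uK; first by exists 1; rewrite [LHS]flatmx0 [RHS]flatmx0.
exists ((n.+1 + n).-root (t / \det K ^+ 2)); rewrite invconeZ rootCK // invcone_unitmx //.
by rewrite scalerA mulfVK // expf_neq0 // -unitfE -unitmxE.
Qed.

Section InverseTraces.
Variables (F : fieldType) (n d : nat) (B : d.-tuple 'M[F]_n).

Definition inverse_traces : d.-tuple {mpoly F[d]} := trace_polys B (invcone (pencil B)).

Lemma meval_inverse_traces v k :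
  (tnth inverse_traces k).@[v] = trace_coord B (invcone (lincomb B v)) k.
Proof. by rewrite meval_trace_polys map_invcone meval_pencil. Qed.

Lemma dirderiv_inverse_traces v w k (K := lincomb B v) (W := lincomb B w) :
  K \in unitmx ->
  dirderiv v w (tnth inverse_traces k) =
  \det K ^+ 2 * ((\tr (invmx K *m W) *+ 2) * trace_coord B (invmx K) k -
                 trace_coord B (invmx K *m W *m invmx K) k).
Proof.
move=> uK; rewrite dirderiv_trace_polys.
rewrite (derivation_invcone (@dirderiv_derivation F d v w)) ?meval_pencil //.
by rewrite dirderiv_pencil trace_coordZ trace_coordB trace_coordZ.
Qed.

(* If the differential at K kills W, pairing it with K gives (2 n - 1) tr (K^-1 W) = 0. *)
Lemma dirderiv_inverse_traces_eq0 v w (K := lincomb B v) (W := lincomb B w) :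
  [pchar F] =i pred0 -> K \in unitmx ->
  (forall k, dirderiv v w (tnth inverse_traces k) = 0) <->
  (forall k, trace_coord B (invmx K *m W *m invmx K) k = 0).
Proof.
move=> char0 uK; have q0 : \det K ^+ 2 != 0 by rewrite expf_neq0 // -unitfE -unitmxE.
set t := \tr (invmx K *m W).
have tE : t = \sum_k v k * trace_coord B (invmx K *m W *m invmx K) k.
  by rewrite -trace_lincomb -/K mulmxA mulKVmx // mxtrace_mulC.
suff t0 : (forall k, trace_coord B (invmx K *m W *m invmx K) k =
                     t *+ 2 * trace_coord B (invmx K) k) -> t = 0.
  split=> [dw|BW] k.
    have BW j : trace_coord B (invmx K *m W *m invmx K) j = t *+ 2 * trace_coord B (invmx K) j.
      apply/eqP; have /eqP := dw j; rewrite dirderiv_inverse_traces // mulf_eq0 (negPf q0) /=.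
      by rewrite subr_eq0 eq_sym.
    by rewrite BW (t0 BW) mul0rn mul0r.
  rewrite dirderiv_inverse_traces // BW subr0 -/K -/W -/t tE big1 ?mul0rn ?mul0r ?mulr0 // => j _.
  by rewrite BW mulr0.
move=> BW; have : t = t *+ 2 * n%:R.
  rewrite -[n%:R]mxtrace1 -(mulmxV uK) trace_lincomb mulr_sumr {1}tE.
  by apply: eq_bigr => k _; rewrite BW mulrCA.
exact: (mulr_even_fix_eq0 char0).
Qed.

End InverseTraces.

(** * Orthogonal complement *)

Lemma CC_char0 : [pchar CC] =i pred0.
Proof. exact: pchar_num. Qed.

Lemma CC_two_neq0 : 2 != 0 :> CC.
Proof. by rewrite pnatr_eq0. Qed.

Section Perp.
Variables (n : nat) (L : {vspace 'M[CC]_n}).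

Lemma Lperp0 : Lperp L 0.
Proof. by split=> [|K _]; rewrite ?/symm ?trmx0 // mulmx0 mxtrace0. Qed.

Lemma LperpD S T : Lperp L S -> Lperp L T -> Lperp L (S + T).
Proof.
move=> [sS S0] [sT T0]; split=> [|K KL]; first by rewrite /symm linearD /= sS sT.
by rewrite mulmxDr mxtraceD S0 // T0 // addr0.
Qed.

Lemma LperpZ a S : Lperp L S -> Lperp L (a *: S).
Proof.
move=> [sS S0]; split=> [|K KL]; first by rewrite /symm linearZ /= sS.
by rewrite -scalemxAr mxtraceZ S0 // mulr0.
Qed.

Lemma LperpN S : Lperp L S -> Lperp L (- S).
Proof. by rewrite -scaleN1r; apply: LperpZ. Qed.

Lemma exists_basis_perp : exists c (A : c.-tuple 'M[CC]_n), basis_perp L A.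
Proof.
have [|U UP] := exists_vspaceP Lperp0; first by move=> a S T pS pT; apply/LperpD/pT/LperpZ.
exists (\dim U), (vbasis U); split; first exact: (basis_free (vbasisP U)).
  by move=> i; apply/UP/vbasis_mem/mem_tnth.
by move=> S /UP; rewrite (span_basis (vbasisP U)).
Qed.

Lemma basis_perp_span c (A : c.-tuple 'M[CC]_n) S :
  basis_perp L A -> S \in <<A>>%VS <-> Lperp L S.
Proof.
move=> [_ pA Aspan]; split=> [/span_lincombP [v ->]|/Aspan //].
by apply: (big_ind (Lperp L)) => [|? ?|i _]; [apply: Lperp0|apply: LperpD|apply: LperpZ].
Qed.

End Perp.

Section PerpOfBasis.
Variables (n d : nat) (L : {vspace 'M[CC]_n}) (B : d.-tuple 'M[CC]_n).
Hypotheses (symL : sym_subspace L) (basisB : basis_of L B).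

Lemma mem_basis_lincombP K : K \in L <-> exists v, K = lincomb B v.
Proof. by rewrite -(span_basis basisB); apply: span_lincombP. Qed.

Lemma mem_lincomb v : lincomb B v \in L.
Proof. by apply/mem_basis_lincombP; exists v. Qed.

Lemma basis_sym k : (tnth B k)^T = tnth B k.
Proof. by apply/symL/(basis_mem basisB)/mem_tnth. Qed.

Lemma Lperp_trace_coordP S : Lperp L S <-> symm S /\ forall k, trace_coord B S k = 0.
Proof.
split=> [[sS S0]|[sS BS]]; split=> //.
  by move=> k; apply/S0/(basis_mem basisB)/mem_tnth.
by move=> _ /mem_basis_lincombP [v ->]; rewrite trace_lincomb big1 // => k _; rewrite BS mulr0.
Qed.

Lemma trace_coord_perp S A : Lperp L A -> trace_coord B (S + A) =1 trace_coord B S.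
Proof. by move=> /Lperp_trace_coordP [_ A0] k; rewrite trace_coordD A0 addr0. Qed.

Lemma perp_Lperp Y : symm Y -> (forall S, Lperp L S -> \tr (Y *m S) = 0) -> Y \in L.
Proof.
move=> sY Y_perp; apply: contraT => YL.
have YB_free : free (cons_tuple Y B).
  by rewrite free_cons (span_basis basisB) YL (basis_free basisB).
have [|T [sT YBT]] := exists_trace_dual CC_two_neq0 YB_free.
  by move=> k; case: (unliftP 0 k) => [j|] ->; rewrite ?tnthS ?tnth0 ?basis_sym.
pose S := lincomb T (fun i => (i == 0)%:R).
have YS : \tr (Y *m S) = 1 by have := YBT (fun i => (i == 0)%:R) 0; rewrite /trace_coord tnth0.
suff : \tr (Y *m S) = 0 by rewrite YS => /eqP; rewrite oner_eq0.
apply/Y_perp/Lperp_trace_coordP; split=> [|k]; first exact: sT.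
by have := YBT (fun i => (i == 0)%:R) (lift 0 k); rewrite /trace_coord tnthS.
Qed.

End PerpOfBasis.

(** * Polynomial functions on matrices and the reciprocal variety *)

Definition generic_mx (R : nzRingType) n : 'M[{mpoly R[n * n]}]_n := vec_mx (\row_i 'X_i).

Section Evaluation.
Variable n : nat.
Implicit Types (p : {mpoly CC[n * n]}) (A : 'M[CC]_n).

Lemma meval_generic_mx A : map_mx (meval (fun i => mxvec A 0 i)) (generic_mx CC n) = A.
Proof.
apply: (can_inj mxvecK); apply/rowP => i.
by rewrite -map_mxvec vec_mxK !mxE mevalXU.
Qed.

Lemma ev_det_generic A : ev (\det (generic_mx CC n)) A = \det A.
Proof. by rewrite /ev -det_map_mx meval_generic_mx. Qed.

Lemma ev_trace_polys_generic d (B : d.-tuple 'M[CC]_n) A k :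
  ev (tnth (trace_polys B (generic_mx CC n)) k) A = trace_coord B A k.
Proof. by rewrite /ev meval_trace_polys meval_generic_mx. Qed.

Lemma trace_polys_generic_dhomog d (B : d.-tuple 'M[CC]_n) k :
  tnth (trace_polys B (generic_mx CC n)) k \is 1.-homog.
Proof.
rewrite tnth_mktuple rpred_sum // => i _; rewrite mxE rpred_sum // => j _.
by rewrite !mxE mul_mpolyC rpredZ // dhomogX /= mdeg1.
Qed.

Definition subst_mx d p (M : 'M[{mpoly CC[d]}]_n) : {mpoly CC[d]} :=
  p \mPo [tuple mxvec M 0 i | i < n * n].

Lemma meval_subst_mx d p (M : 'M[{mpoly CC[d]}]_n) v :
  (subst_mx p M).@[v] = ev p (map_mx (meval v) M).
Proof.
rewrite comp_mpoly_meval; apply: meval_eq => i.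
by rewrite tnth_mktuple -map_mxvec mxE.
Qed.

End Evaluation.

Section Reciprocal.
Variables (n : nat) (L : {vspace 'M[CC]_n}).
Hypothesis symL : sym_subspace L.

Lemma reciprocal_invcone K : K \in L -> K \in unitmx -> reciprocal L (invcone K).
Proof.
move=> KL uK p; apply; have q0 : \det K ^+ 2 != 0 by rewrite expf_neq0 // -unitfE -unitmxE.
have uqK : (\det K ^+ 2)^-1 *: K \in unitmx by rewrite unitmxZ // unitfE invr_eq0.
exists ((\det K ^+ 2)^-1 *: K); first exact: memvZ.
by rewrite invmxZ // invrK invcone_unitmx.
Qed.

Lemma reciprocal_symm X : reciprocal L X -> symm X.
Proof.
move=> rX; apply/matrixP => i j; rewrite mxE; apply/eqP; rewrite -subr_eq0.
have evE Y : ev (generic_mx CC n j i - generic_mx CC n i j) Y = Y j i - Y i j.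
  by rewrite -{2 3}(meval_generic_mx Y) !mxE -mevalB.
rewrite -evE; apply/eqP/rX => _ [K KL [uK ->]]; rewrite evE.
have sK : (invmx K)^T = invmx K by rewrite trmx_inv symL.
by rewrite -[in X in X - _]sK mxE subrr.
Qed.

End Reciprocal.

(** * The intersection of L with K L^perp K *)

Definition congr_perp_meets n (L : {vspace 'M[CC]_n}) (K : 'M[CC]_n) :=
  exists X, [/\ X \in L, X <> 0 & exists2 S, Lperp L S & X = K *m S *m K].

Lemma meval_Mmat n c d (A : c.-tuple 'M[CC]_n) (B : d.-tuple 'M[CC]_n) v (K := lincomb B v) :
  map_mx (meval v) (Mmat A B) = \matrix_(i, j) \tr (tnth A i *m K *m tnth A j *m K).
Proof.
apply/matrixP => i j; rewrite !mxE raddf_sum /=.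
rewrite [tnth A i *m K]mulmx_sumr !mulmx_suml (raddf_sum (mxtrace (n := n))) /=.
apply: eq_bigr => k _.
rewrite raddf_sum mulmx_sumr (raddf_sum (mxtrace (n := n))) /=; apply: eq_bigr => l _.
rewrite !mevalM !mevalXU mevalC -scalemxAr mxtraceZ -scalemxAr -!scalemxAl mxtraceZ.
by rewrite mulrA [v l * v k]mulrC.
Qed.

Lemma mul_Mmat n c d (A : c.-tuple 'M[CC]_n) (B : d.-tuple 'M[CC]_n) v (x : 'rV_c)
    (K := lincomb B v) :
  x *m map_mx (meval v) (Mmat A B) = \row_j trace_coord A (K *m lincomb A (x 0) *m K) j.
Proof.
rewrite meval_Mmat; apply/rowP => j; rewrite !mxE /trace_coord.
rewrite mxtrace_mulC -!mulmxA mxtrace_mulC -!mulmxA trace_lincomb.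
by apply: eq_bigr => i _; rewrite mxE /trace_coord !mulmxA.
Qed.

Section CongruentPerp.
Variables (n d : nat) (L : {vspace 'M[CC]_n}) (B : d.-tuple 'M[CC]_n).
Hypotheses (symL : sym_subspace L) (basisB : basis_of L B).

Lemma jacobian_inverse_traces_eq0 v (K := lincomb B v) : K \in unitmx ->
  (\det (jacobian (inverse_traces B))).@[v] = 0 <-> congr_perp_meets L K.
Proof.
move=> uK; have sK : (invmx K)^T = invmx K by rewrite trmx_inv symL //; apply: (mem_lincomb basisB).
pose PX X := forall k, trace_coord B (invmx K *m X *m invmx K) k = 0.
rewrite -det_map_mx (det_eq0_lincombP (P := PX) (basis_free basisB)) => [|w]; last first.
  rewrite mul_jacobian_dirderiv.
  apply: iff_trans (dirderiv_inverse_traces_eq0 (w 0) CC_char0 uK).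
  by split=> [/rowP dw k|dw]; [have := dw k|apply/rowP => k]; rewrite !mxE.
rewrite (span_basis basisB).
split=> -[X [XL X0 XB]]; exists X; split=> //.
  exists (invmx K *m X *m invmx K); last by rewrite !mulmxA mulmxV // mul1mx mulmxKV.
  apply/(Lperp_trace_coordP basisB); split=> //.
  by rewrite /symm !trmx_mul sK (symL XL) mulmxA.
case: XB => S /(Lperp_trace_coordP basisB) [_ BS] -> k.
by rewrite -!mulmxA mulmxV // mulmx1 mulKmx.
Qed.

Lemma det_Mmat_eq0 c (A : c.-tuple 'M[CC]_n) v (K := lincomb B v) :
  basis_perp L A -> K \in unitmx ->
  (\det (Mmat A B)).@[v] = 0 <-> congr_perp_meets L K.
Proof.
move=> basisA uK; have [A_free pA _] := basisA.
have sK : K^T = K by apply/symL/mem_lincomb.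
pose PS S := forall j, trace_coord A (K *m S *m K) j = 0.
rewrite -det_map_mx (det_eq0_lincombP (P := PS) A_free) => [|x]; last first.
  by rewrite mul_Mmat; split=> [/rowP xM j|xM]; [have := xM j|apply/rowP => j]; rewrite !mxE.
split=> [[S [/(basis_perp_span _ basisA) pS S0 AS]]|[X [XL X0 [S pS XE]]]].
  exists (K *m S *m K); split; last by exists S.
    apply: (perp_Lperp symL basisB); first by rewrite /symm !trmx_mul sK (proj1 pS) mulmxA.
    move=> T /(basis_perp_span _ basisA)/span_lincombP [y ->].
    by rewrite mxtrace_mulC trace_lincomb big1 // => j _; rewrite AS mulr0.
  move=> KSK0; apply: S0; apply: (can_inj (mulKmx uK)); apply: (can_inj (mulmxK uK)).
  by rewrite KSK0 mulmx0 mul0mx.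
exists S; split; first exact/(basis_perp_span _ basisA).
  by move=> S0; apply: X0; rewrite XE S0 mulmx0 mul0mx.
by move=> j; rewrite -XE /trace_coord mxtrace_mulC (proj2 (pA j)).
Qed.

Lemma mpoly_eq0_regular (f : {mpoly CC[d]}) : regular L ->
  (forall v, lincomb B v \in unitmx -> f.@[v] = 0) -> f = 0.
Proof.
have det_pencil v : (\det (pencil B)).@[v] = \det (lincomb B v).
  by rewrite -det_map_mx meval_pencil.
move=> [K /(mem_basis_lincombP basisB) [v0 ->] uK] f0.
have : f * \det (pencil B) = 0.
  apply: (mpoly_eq0_meval CC_char0) => v; rewrite mevalM det_pencil.
  have [->|q0] := eqVneq (\det (lincomb B v)) 0; first by rewrite mulr0.
  by rewrite f0 ?mul0r // unitmxE unitfE.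
move/eqP; rewrite mulf_eq0 => /orP [/eqP //|/eqP q0].
by move: uK; rewrite unitmxE unitfE -det_pencil q0 meval0 eqxx.
Qed.

Lemma generic_inP (q : {mpoly CC[d]}) (P : 'M[CC]_n -> Prop) : regular L ->
  (forall v, lincomb B v \in unitmx -> q.@[v] = 0 <-> P (lincomb B v)) ->
  generic_in L P <-> q = 0.
Proof.
move=> regL qP; split=> [[p [[K0 /(mem_basis_lincombP basisB) [v0 ->] pK0] pP]]|q0].
  have : q * subst_mx p (pencil B) = 0.
    apply: mpoly_eq0_regular => // v uK; rewrite mevalM meval_subst_mx meval_pencil.
    have [->|/eqP pK] := eqVneq (ev p (lincomb B v)) 0; first by rewrite mulr0.
    by rewrite (iffRL (qP v uK)) ?mul0r //; apply: pP => //; apply: mem_lincomb.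
  move/eqP; rewrite mulf_eq0 => /orP [/eqP //|/eqP p0].
  by case: pK0; rewrite -meval_pencil -meval_subst_mx p0 meval0.
have [K1 K1L uK1] := regL; exists (\det (generic_mx CC n)); split.
  by exists K1 => //; apply/eqP; rewrite ev_det_generic -unitfE -unitmxE.
move=> _ /(mem_basis_lincombP basisB) [v ->] /eqP; rewrite ev_det_generic -unitfE -unitmxE => uK.
by apply: (iffLR (qP v uK)); rewrite q0 meval0.
Qed.

End CongruentPerp.

(** * The equivalences *)

Section Equivalences.
Variables (n : nat) (L : {vspace 'M[CC]_n}).
Hypotheses (symL : sym_subspace L) (regL : regular L).
Let B := vbasis L.
Let basisB : basis_of L B := vbasisP L.

Lemma generic_congr_perp_meets_jacobian :
  generic_in L (congr_perp_meets L) <-> \det (jacobian (inverse_traces B)) = 0.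
Proof. by apply: (generic_inP basisB regL) => v; apply: jacobian_inverse_traces_eq0. Qed.

Lemma generic_congr_perp_meets_Mmat c d (A : c.-tuple 'M[CC]_n) (B' : d.-tuple 'M[CC]_n) :
  basis_perp L A -> basis_of L B' ->
  generic_in L (congr_perp_meets L) <-> \det (Mmat A B') = 0.
Proof. by move=> basisA basisB'; apply: (generic_inP basisB' regL) => v; apply: det_Mmat_eq0. Qed.

Lemma not_dominant_ML_degree0 : ~ proj_restr_dominant L -> ML_degree_is L 0.
Proof.
move/NNPP => [f [e [_ f_inv [S0 [sS0 fS0]] f_rec]]].
exists f; split=> [|S sS fS]; first by exists S0.
exists [::]; split=> // X; split=> // -[rX [A pA XE]]; case: fS.
by rewrite -(f_inv S A) // addrC -XE f_rec.
Qed.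

Lemma ML_degree0_join : ML_degree_is L 0 -> exists S, symm S /\ ~ join_cone L S.
Proof.
move=> [p [[S0 [sS0 pS0]] pML]]; exists S0; split=> // joinS0; apply/pS0/joinS0.
move=> _ [X [A [rX pA ->]]]; apply/eqP/negPn/negP => /eqP pXA.
have sXA : symm (X + A) by rewrite /symm linearD /= (reciprocal_symm symL rX) (proj1 pA).
have [s [_ /size0nil -> /(_ X) [_ noX]]] := pML _ sXA pXA.
suff : X \in [::] by []; apply: noX; split=> //.
by exists (- A); [apply: LperpN|rewrite addrC addrK].
Qed.

Lemma exists_trace_section : exists T : (\dim L).-tuple 'M[CC]_n,
  (forall v, symm (lincomb T v)) /\ forall v, trace_coord B (lincomb T v) =1 v.
Proof.
apply: exists_trace_dual (basis_free basisB) (basis_sym symL basisB); exact: CC_two_neq0.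
Qed.

(* The polynomial p vanishing on L^-1 + L^perp but not at S0 is pulled back to coordinates along
   the affine section through S0 of the projection from L^perp. *)
Lemma join_alg_dependent : (exists S, symm S /\ ~ join_cone L S) ->
  alg_dependent (inverse_traces B).
Proof.
move=> [S0 [sS0 joinS0]]; have [p not_pjoin] := not_all_ex_not _ _ joinS0.
have [p_join pS0] := imply_to_and _ _ not_pjoin.
have [T [sT BT]] := exists_trace_section.
pose C := S0 - lincomb T (trace_coord B S0).
have sC : symm C by rewrite /symm linearB /= sS0 sT.
pose f := subst_mx p (pencil T + map_mx (@mpolyC _ CC) C).
have fE y : f.@[y] = ev p (lincomb T y + C).
  by rewrite meval_subst_mx map_mxD meval_pencil map_mx_mevalC.
exists f.
  apply: contra_notN pS0 => /eqP f0; have := fE (trace_coord B S0).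
  by rewrite f0 meval0 addrC subrK.
apply: (mpoly_eq0_regular basisB regL) => v uK; rewrite comp_mpoly_meval fE.
set y := fun k => _; pose X := invcone (lincomb B v).
have yE : y =1 trace_coord B X by move=> k; apply: meval_inverse_traces.
have rX : reciprocal L X by apply: reciprocal_invcone => //; apply: mem_lincomb.
apply: p_join; exists X, (lincomb T y + C - X); split=> //; last by rewrite [RHS]addrC subrK.
apply/(Lperp_trace_coordP basisB); split=> [|k].
  by rewrite /symm linearB linearD /= sT sC (reciprocal_symm symL rX).
by rewrite trace_coordB trace_coordD trace_coordB !BT yE subrr addr0 subrr.
Qed.

(* The homogeneous components of a relation f between the coordinates of det K ^ 2 K^-1 vanish at
   those of K^-1, because L^-1 is a cone. *)
Lemma alg_dependent_not_dominant : alg_dependent (inverse_traces B) -> ~ proj_restr_dominant L.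
Proof.
move=> [f f0 fB]; apply; have [e fe0] := exists_pihomog_neq0 f0.
pose F := pihomog mdeg e f \mPo trace_polys B (generic_mx CC n).
have FE S : ev F S = (pihomog mdeg e f).@[trace_coord B S].
  by rewrite /ev comp_mpoly_meval; apply: meval_eq => k; apply: ev_trace_polys_generic.
exists F, e; split.
- apply: dhomog_comp_linear; [exact: pihomogP|exact: trace_polys_generic_dhomog].
- by move=> S A _ pA; rewrite !FE; apply: meval_eq; apply: (trace_coord_perp basisB).
- have [T [sT BT]] := exists_trace_section; have [y fy] := mpoly_neq0_meval CC_char0 fe0.
  exists (lincomb T y); split=> //; apply/eqP; rewrite FE.
  by rewrite (meval_eq _ (BT y)).
move=> X; apply=> _ [K KL [uK ->]]; rewrite FE.
apply: (meval_pihomog_eq0 CC_char0) => t _.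
have [c cK] := exists_invcone_eq t uK.
have /(mem_basis_lincombP basisB) [v cKv] : c *: K \in L by apply: memvZ.
have := congr1 (meval v) fB; rewrite meval0 comp_mpoly_meval => fBv; rewrite -[RHS]fBv.
by apply: meval_eq => k; rewrite meval_inverse_traces -cKv cK trace_coordZ.
Qed.

End Equivalences.

Theorem theorem6p1 (n : nat) (L : {vspace 'M[CC]_n}) :
  sym_subspace L -> regular L ->
  [<-> ML_degree_is L 0;
       ~ proj_restr_dominant L;
       (exists S : 'M[CC]_n, symm S /\ ~ join_cone L S);
       generic_in L (fun K => exists X, [/\ X \in L, X <> 0 &
                       exists2 S, Lperp L S & X = K *m S *m K]);
       (forall (c d : nat) (A : c.-tuple 'M[CC]_n) (B : d.-tuple 'M[CC]_n),
          basis_perp L A -> basis_of L B -> \det (Mmat A B) = 0)].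
Proof.
move=> symL regL; have join_dep := join_alg_dependent symL regL.
have dep_dom := alg_dependent_not_dominant symL.
have dom_ML := @not_dominant_ML_degree0 n L.
have ML_join := ML_degree0_join symL.
have dep_generic : alg_dependent (inverse_traces (vbasis L)) <-> generic_in L (congr_perp_meets L).
  rewrite generic_congr_perp_meets_jacobian //.
  by split; [apply: alg_dependent_jacobian|apply: jacobian_alg_dependent]; apply: CC_char0.
tfae.
- by move/ML_join/join_dep/dep_dom.
- by move/dom_ML/ML_join.
- by move/join_dep/dep_generic.
- by move=> gL c d A B basisA basisB; apply/(generic_congr_perp_meets_Mmat symL regL basisA basisB).
- move=> M0; have [c [A basisA]] := exists_basis_perp L.
  apply/dom_ML/dep_dom/dep_generic.
  apply/(generic_congr_perp_meets_Mmat symL regL basisA (vbasisP L)).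
  exact: M0 (vbasisP L).
Qed.
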